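(* Let $p\ge 1$ and let $s:\mathbb{R}^p\to\mathbb{R}_{\ge}$ be a norm that is strictly $\Pi^{\min}$-monotone. Let $S=\{s_w : w\in\mathbb{R}^p_>\}$ be the weighted scalarization induced by $W=\mathbb{R}^p_>$ and $s$, where $s_w:\mathbb{R}^p_>\to\mathbb{R}$, $s_w(y)=s(w_1y_1,\ldots,w_py_p)$, and denote by $e^i$ the $i$-th unit vector in $\mathbb{R}^p$. Then $$\inf_{\bar y\in\mathbb{R}^p_>}\ \sup\left\{\max\left\{\frac{y^*_1}{\bar y_1},\ldots,\frac{y^*_p}{\bar y_p}\right\}\ \middle|\ y^*\in L(\bar y,s)\right\} = s\left(\frac{1}{s(e^1)},\ldots,\frac{1}{s(e^p)}\right)=:\alpha.$$ Moreover, 1. in each instance of each $p$-objective minimization problem, every optimal solution set for $S$ is an $\alpha$-approximation set, and 2. for each $0<\varepsilon<1$, there exists an instance of a $p$-objective minimization problem where the set of $S$-supported solutions is not an $(\alpha\cdot(1-\varepsilon))$-approximation set.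
   Context: $\mathbb{R}^p_> = \{y \in \mathbb{R}^p : y_i > 0 \text{ for } i=1,\ldots,p\}$ and $\mathbb{R}_{\ge}=[0,\infty)$. $\Pi^{\min}=(\{1,\ldots,p\},\emptyset)$ denotes the decomposition in which all $p$ objectives are to be minimized. A function $s$ is strictly $\Pi^{\min}$-monotone if for all $y,y'\in\mathbb{R}^p_>$ with $y_i<y'_i$ for all $i=1,\ldots,p$ one has $s(y)<s(y')$. The level set is $L(\bar y,s)=\{y\in\mathbb{R}^p_> : s(y)=s(\bar y)\}$. A $p$-objective minimization problem is a set of instances; each instance $(X,f)$ consists of a set $X$ of feasible solutions and a vector $f=(f_1,\ldots,f_p)$ of objective functions on $X$, all to be minimized. Standing assumption: in every instance, $f(X)$ is a compact subset of $\mathbb{R}^p_>$. For a factor $\gamma>0$, a set $P\subseteq X$ is a $\gamma$-approximation set if for every $x'\in X$ there is $x\in P$ with $f_i(x)\le\gamma f_i(x')$ for all $i=1,\ldots,p$. In an instance $(X,f)$, $x\in X$ is optimal for $s_w$ if $s_w(f(x))\le s_w(f(x'))$ for all $x'\in X$; $x$ is $S$-supported if it is optimal for some $s_w\in S$; a set $P\subseteq X$ is an optimal solution set for $S$ if for each $s_w\in S$ there is some $x\in P$ that is optimal for $s_w$. *)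

(* Defs.v *)
From mathcomp Require Import all_boot all_order all_algebra.
From mathcomp Require Import all_classical all_reals all_analysis.

Set Implicit Arguments.
Unset Strict Implicit.
Unset Printing Implicit Defensive.

Import Order.TTheory GRing.Theory Num.Theory.
Import numFieldNormedType.Exports.

Local Open Scope classical_set_scope.
Local Open Scope ring_scope.

Section Defs.
Context {R : realType} {p : nat}.

Record is_norm (s : 'rV[R]_p -> R) : Prop := IsNorm {
  is_norm_ge0 : forall y, 0 <= s y;
  is_norm_eq0 : forall y, s y = 0 -> y = 0;
  is_normZ : forall (a : R) y, s (a *: y) = `|a| * s y;
  is_normD : forall y z, s (y + z) <= s y + s z }.

Definition positive_orthant : set 'rV[R]_p := [set y | forall i, 0 < y 0 i].

Definition strictly_min_monotone (s : 'rV[R]_p -> R) : Prop :=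
  forall y y', positive_orthant y -> positive_orthant y' ->
    (forall i, y 0 i < y' 0 i) -> s y < s y'.

Definition level_set (ybar : 'rV[R]_p) (s : 'rV[R]_p -> R) : set 'rV[R]_p :=
  [set y | positive_orthant y /\ s y = s ybar].

(* Taken in \bar R so that -oo is the neutral element: for 0 < p this is the
   plain maximum of the quotients, with no convention about a default value. *)
Definition max_ratio (y ybar : 'rV[R]_p) : \bar R :=
  \big[maxe/-oo%E]_(i < p) (y 0 i / ybar 0 i)%:E.

(* Scalarizations are total functions on R^p; they are only ever evaluated at
   points of the positive orthant, where all objective vectors lie. *)
Definition weighted_scal (s : 'rV[R]_p -> R) (w : 'rV[R]_p) : 'rV[R]_p -> R :=
  fun y => s (\row_i (w 0 i * y 0 i)).

Definition weighted_scalarization (W : set 'rV[R]_p) (s : 'rV[R]_p -> R) :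
  set ('rV[R]_p -> R) := [set weighted_scal s w | w in W].

End Defs.

Arguments positive_orthant : clear implicits.

(* The feasible set is an arbitrary, possibly empty, type. *)
Record instance (R : realType) (p : nat) := Instance {
  feasible : Type;
  objective : feasible -> 'rV[R]_p;
  objective_gt0 : range objective `<=` positive_orthant R p;
  objective_compact : compact (range objective) }.

Definition minimization_problem (R : realType) (p : nat) := set (instance R p).

Section Solutions.
Context {R : realType} {p : nat} (I : instance R p).

Definition approximation_set (gamma : R) (P : set (feasible I)) : Prop :=
  forall x' : feasible I, exists2 x : feasible I, P x &
    forall i, objective x 0 i <= gamma * objective x' 0 i.

Definition optimal (t : 'rV[R]_p -> R) (x : feasible I) : Prop :=
  forall x' : feasible I, t (objective x) <= t (objective x').

Definition supported (S : set ('rV[R]_p -> R)) : set (feasible I) :=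
  [set x | exists2 t, S t & optimal t x].

Definition optimal_solution_set (S : set ('rV[R]_p -> R))
  (P : set (feasible I)) : Prop :=
  forall t, S t -> exists2 x, P x & optimal t x.

End Solutions.

(* Main.v *)
Require Import Defs.
From mathcomp Require Import all_boot all_order all_algebra.
From mathcomp Require Import all_classical all_reals all_analysis.
From mathcomp Require Import ring lra.

Set Implicit Arguments.
Unset Strict Implicit.
Unset Printing Implicit Defensive.

Import Order.TTheory GRing.Theory Num.Theory.
Import numFieldNormedType.Exports.

Local Open Scope classical_set_scope.
Local Open Scope ring_scope.

(** Since [s] is continuous, strict monotonicity on the open orthant gives weak
    monotonicity on the closed one, hence [z_i * s e_i <= s z] for [z >= 0].
    Conversely, if [j] minimizes [z_j * s e_j], then [z] dominates the vector
    [z_j * s e_j * (1 / s e_i)_i], so that [alpha * (z_j * s e_j) <= s z].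
    The first inequality, at the point [ybar = (1 / s e_i)_i], gives every upper
    bound.  The second one gives the lower bounds, tested on the vectors
    [c * z_j * e_j + d * z] with [d] small: these are much larger than [z] in
    coordinate [j], yet not larger for [s].  For the instance of the last claim,
    taking all of these for [z = ybar] together with [ybar] makes [ybar]
    unsupported, because [j] may be chosen after the weight. *)

Section MonotoneNorm.
Context {R : realType} {p : nat} {s : 'rV[R]_p -> R}.
Context (s_norm : is_norm s) (s_mono : strictly_min_monotone s).

Local Notation e i := (delta_mx 0 i : 'rV[R]_p).
Local Notation yinv := (\row_i (1 / s (e i)) : 'rV[R]_p).
Local Notation alpha := (s yinv).

Lemma norm_ge0Z (a : R) y : 0 <= a -> s (a *: y) = a * s y.
Proof. by move=> a0; rewrite (is_normZ s_norm) ger0_norm. Qed.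

Lemma norm_gt0 y : y != 0 -> 0 < s y.
Proof.
move=> y0; rewrite lt_neqAle (is_norm_ge0 s_norm) andbT eq_sym.
by apply: contra y0 => /eqP /(is_norm_eq0 s_norm) ->.
Qed.

Lemma norm_unit_gt0 i : 0 < s (e i).
Proof.
apply: norm_gt0; apply/eqP => /rowP /(_ i).
by rewrite !mxE !eqxx => /eqP; rewrite oner_eq0.
Qed.

(** The argument [i] rules out [p = 0], where the orthant contains the zero vector. *)
Lemma norm_orthant_gt0 (i : 'I_p) y : positive_orthant R p y -> 0 < s y.
Proof.
move=> yp; apply: norm_gt0; apply/eqP => /rowP /(_ i) yi.
by have := yp i; rewrite yi mxE ltxx.
Qed.

Lemma norm_le (y z : 'rV[R]_p) :
  (forall i, 0 <= y 0 i) -> (forall i, y 0 i <= z 0 i) -> s y <= s z.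
Proof.
move=> y0 yz; pose u : 'rV[R]_p := const_mx 1.
have su0 : 0 <= s u := is_norm_ge0 s_norm u.
apply/ler_addgt0Pr => eps eps0.
(* Shifting [y] by [d *: u] and [z] by twice as much makes both positive and strictly ordered, at a
   total cost of [3 * d * s u]; the [+ 1] keeps the denominator positive. *)
pose d := eps / (3 * (s u + 1)).
have d0 : 0 < d by rewrite divr_gt0// mulr_gt0// ltr_wpDl.
have lt_yz : s (y + d *: u) < s (z + (2 * d) *: u).
  apply: s_mono => i; rewrite !mxE mulr1.
  - by rewrite ltr_wpDl.
  - by rewrite (ltr_wpDl (le_trans (y0 i) (yz i)))// mulr_gt0.
  - by have := yz i; lra.
have leDy : s y <= s (y + d *: u) + d * s u.
  rewrite -{1}(addrK (d *: u) y) (le_trans (is_normD s_norm _ _))//.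
  by rewrite -scaleNr (is_normZ s_norm) normrN gtr0_norm.
have leDz : s (z + (2 * d) *: u) <= s z + 2 * d * s u.
  by rewrite (le_trans (is_normD s_norm _ _))// norm_ge0Z// mulr_ge0// ltW.
have dE : 3 * d * (s u + 1) = eps.
  by rewrite /d; field; rewrite gt_eqF// ltr_wpDl.
by rewrite -dE; lra.
Qed.

Lemma coord_norm_le z i : positive_orthant R p z -> z 0 i * s (e i) <= s z.
Proof.
move=> zp; rewrite -norm_ge0Z; last exact: ltW.
apply: norm_le => k; rewrite !mxE eqxx /=.
  by rewrite mulr_ge0 ?ler0n// ltW.
by case: eqVneq => [->|_]; rewrite ?mulr1// mulr0 ltW.
Qed.

Lemma min_coord_norm_le (i0 : 'I_p) z : positive_orthant R p z ->
  exists j, alpha * (z 0 j * s (e j)) <= s z.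
Proof.
move=> zp.
have [j _ jmin] := @arg_minP _ _ _ i0 xpredT (fun j => z 0 j * s (e j)) isT.
exists j; set m := z 0 j * s (e j).
have m0 : 0 <= m by rewrite mulr_ge0 ?(ltW (zp j))// ltW// norm_unit_gt0.
rewrite mulrC -norm_ge0Z//; apply: norm_le => i; rewrite !mxE mul1r.
  by rewrite mulr_ge0// invr_ge0 ltW// norm_unit_gt0.
by rewrite ler_pdivrMr ?norm_unit_gt0// jmin.
Qed.

Lemma inv_units_orthant : positive_orthant R p yinv.
Proof. by move=> i; rewrite mxE divr_gt0// norm_unit_gt0. Qed.

(** The summand [d *: z] only serves to move the multiple of [e j] off the boundary of the
    orthant. *)
Definition spike (c d : R) (z : 'rV[R]_p) (j : 'I_p) : 'rV[R]_p :=
  (c * z 0 j) *: e j + d *: z.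

Lemma spike_orthant c d z j : 0 <= c -> 0 < d ->
  positive_orthant R p z -> positive_orthant R p (spike c d z j).
Proof.
move=> c0 d0 zp i; rewrite !mxE ltr_wpDl ?mulr_gt0//.
by rewrite !mulr_ge0// ltW.
Qed.

Lemma spike_coord c d z j : spike c d z j 0 j = (c + d) * z 0 j.
Proof. by rewrite !mxE !eqxx mulr1 mulrDl. Qed.

Lemma norm_spike_le c d z j : 0 <= c -> 0 <= d -> positive_orthant R p z ->
  s (spike c d z j) <= c * (z 0 j * s (e j)) + d * s z.
Proof.
move=> c0 d0 zp; rewrite (le_trans (is_normD s_norm _ _))//.
by rewrite !norm_ge0Z// ?mulrA// mulr_ge0// ltW.
Qed.

(** Hence [j] can be chosen from the weighted vector rather than from [z]. *)
Lemma spike_weight c d (w z : 'rV[R]_p) j :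
  \row_i (w 0 i * spike c d z j 0 i) = spike c d (\row_i (w 0 i * z 0 i)) j.
Proof.
apply/rowP => i; rewrite !mxE eqxx /=.
by case: eqVneq => [->|_] /=; ring.
Qed.

Lemma max_ratio_le_alpha y :
  level_set yinv s y -> (max_ratio y yinv <= alpha%:E)%E.
Proof.
move=> [yp sy]; rewrite /max_ratio.
elim/big_ind: _ => [|a b a_le b_le|i _]; first exact: leNye.
  by rewrite ge_max a_le.
by rewrite lee_fin mxE div1r invrK -sy coord_norm_le.
Qed.

Lemma alpha_le_sup (i0 : 'I_p) ybar : positive_orthant R p ybar ->
  (alpha%:E <= ereal_sup [set max_ratio y ybar | y in level_set ybar s])%E.
Proof.
move=> yp; have a0 : 0 < alpha by exact/norm_orthant_gt0/inv_units_orthant.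
apply/lee_mul01Pr; first by rewrite lee_fin ltW.
move=> r /andP[r0 r1]; rewrite -EFinM.
have [j jP] := min_coord_norm_le i0 yp.
(* Chosen so that [r * alpha * d = 1 - r]: the slack left by [r] pays exactly for [d *: ybar],
   giving [r * alpha * s v <= s ybar]. *)
pose d := (1 - r) / (r * alpha).
have d0 : 0 < d by rewrite divr_gt0 ?subr_gt0 ?mulr_gt0.
pose v := spike 1 d ybar j.
have vp : positive_orthant R p v by exact: spike_orthant.
have sv0 : 0 < s v by exact: norm_orthant_gt0 vp.
have sy0 : 0 < s ybar by exact: norm_orthant_gt0 yp.
pose y := (s ybar / s v) *: v.
have t0 : 0 < s ybar / s v by rewrite divr_gt0.
have yL : level_set ybar s y.
  split=> [i|]; first by rewrite mxE mulr_gt0.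
  by rewrite norm_ge0Z ?ltW// divfK// gt_eqF.
apply: (@le_trans _ _ (max_ratio y ybar)); last by apply: ereal_sup_ubound; exists y.
apply: (@le_trans _ _ (y 0 j / ybar 0 j)%:E); last first.
  by rewrite /max_ratio (bigD1 j)//= le_max lexx.
rewrite lee_fin mxE spike_coord mulrA mulfK ?gt_eqF// mulrAC ler_pdivlMr//.
have := norm_spike_le j ler01 (ltW d0) yp.
rewrite mul1r -/v -(ler_pM2l (mulr_gt0 r0 a0)) => /le_trans; apply.
have -> : r * alpha * (ybar 0 j * s (e j) + d * s ybar) =
  r * (alpha * (ybar 0 j * s (e j))) + (1 - r) * s ybar.
  by rewrite /d; field; rewrite !gt_eqF.
have := ler_pM2l r0 (alpha * (ybar 0 j * s (e j))) (s ybar); rewrite jP => /idP.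
by have := mulr_gt0 d0 sy0; lra.
Qed.

(** The infimum is attained at [yinv]. *)
Lemma inf_sup_max_ratio (i0 : 'I_p) :
  ereal_inf [set ereal_sup [set max_ratio y ybar | y in level_set ybar s]
            | ybar in positive_orthant R p] = alpha%:E.
Proof.
apply/eqP; rewrite eq_le; apply/andP; split; last first.
  by apply: le_ereal_inf_tmp => _ [ybar yp <-]; exact: alpha_le_sup.
apply: (@le_trans _ _ (ereal_sup [set max_ratio y yinv | y in level_set yinv s])).
  by apply: ereal_inf_lbound; exists yinv => //; exact: inv_units_orthant.
by apply: ge_ereal_sup => _ [y yL <-]; exact: max_ratio_le_alpha.
Qed.

Lemma optimal_approximation (I : instance R p) (P : set (feasible I)) :
  optimal_solution_set (weighted_scalarization (positive_orthant R p) s) P ->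
  approximation_set alpha P.
Proof.
move=> optP x'.
have fp x : positive_orthant R p (objective x) by apply: objective_gt0; exists x.
(* This weight sends the objective vector of [x'] to [yinv], whose norm is [alpha]. *)
pose w : 'rV[R]_p := \row_i (1 / s (e i) / objective x' 0 i).
have wp : positive_orthant R p w.
  by move=> i; rewrite mxE divr_gt0 ?fp// divr_gt0// norm_unit_gt0.
have [|x Px xopt] := optP (weighted_scal s w); first by exists w.
exists x => // i.
have := xopt x'; rewrite /weighted_scal.
have -> : \row_k (w 0 k * objective x' 0 k) = \row_k (1 / s (e k)).
  by apply/rowP => k; rewrite !mxE divfK// gt_eqF// fp.
have wfp : positive_orthant R p (\row_k (w 0 k * objective x 0 k)).
  by move=> k; rewrite mxE mulr_gt0// fp.
move=> /(le_trans (coord_norm_le i wfp)); rewrite !mxE.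
have -> : 1 / s (e i) / objective x' 0 i * objective x 0 i * s (e i) =
  objective x 0 i / objective x' 0 i.
  by field; rewrite !gt_eqF ?fp// norm_unit_gt0.
by rewrite ler_pdivrMr// fp.
Qed.

Lemma supported_not_approximation (i0 : 'I_p) (eps : R) : 0 < eps -> eps < 1 ->
  exists I : instance R p, ~ approximation_set (alpha * (1 - eps))
    (@supported R p I (weighted_scalarization (positive_orthant R p) s)).
Proof.
move=> eps0 eps1; pose z := yinv.
have zp : positive_orthant R p z := inv_units_orthant.
have a0 : 0 < alpha := norm_orthant_gt0 i0 zp.
(* Here [c] exceeds [alpha * (1 - eps)], so spikes are too large in coordinate [j], while
   [d < eps / 2] brings the weighted norm of a suitable spike down to at most [1 - eps / 4] times
   that of [z]. *)
pose c := alpha * (1 - eps / 2); pose d := eps / 4.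
have c0 : 0 <= c by rewrite mulr_ge0 ?ltW//; lra.
have d0 : 0 < d by rewrite divr_gt0.
pose f (x : option 'I_p) := if x is Some j then spike c d z j else z.
(* Feasible solutions are natural numbers, decoded by [insub], because the
   universe of ['I_p] is too large for the field [feasible]. *)
pose g (n : nat) := f (insub n).
have g_gt0 : range g `<=` positive_orthant R p.
  by move=> _ [n _ <-]; rewrite /g; case: insub => [j|] //; exact: spike_orthant.
have g_compact : compact (range g).
  apply: finite_compact; apply: (@sub_finite_set _ _ (range f)).
    by move=> _ [n _ <-]; exists (insub n).
  by apply: finite_image; exact: finite_finset.
(* The code [p] lies outside ['I_p], so it decodes to [None], that is, to [z]. *)
have gp : g p = z by rewrite /g insubF// ltnn.
exists (Instance g_gt0 g_compact) => /(_ p) [n /= supp_n]; rewrite gp => le_n.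
(* No spike approximates [z] within the factor, so the supported solution must have image [z]. *)
have {le_n} gn : g n = z.
  move: le_n; rewrite /g; case: insub => [j|//] /= /(_ j).
  rewrite spike_coord ler_pM2r// /c /d => le_cd; exfalso; move: le_cd.
  by have := mulr_gt0 a0 eps0; lra.
case: supp_n => _ [w wp <-] /= nopt.
pose v : 'rV[R]_p := \row_i (w 0 i * z 0 i).
have vp : positive_orthant R p v by move=> i; rewrite mxE mulr_gt0.
have v0 : 0 < s v := norm_orthant_gt0 i0 vp.
have [j jP] := min_coord_norm_le i0 vp.
have := nopt j; rewrite /weighted_scal /= gn {1}/g valK /= spike_weight -/v.
move=> /le_trans /(_ (norm_spike_le j c0 (ltW d0) vp)).
apply/negP; rewrite -ltNge.
have eps2 : 0 <= 1 - eps / 2 by lra.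
have := ler_wpM2l eps2 jP.
have -> : c * (v 0 j * s (e j)) = (1 - eps / 2) * (alpha * (v 0 j * s (e j))).
  by rewrite /c; ring.
have := mulr_gt0 d0 v0; rewrite /d; lra.
Qed.

End MonotoneNorm.

Theorem theorem5p5 (R : realType) (p : nat) (p_gt0 : (0 < p)%N)
    (s : 'rV[R]_p -> R) (s_norm : is_norm s)
    (s_mono : strictly_min_monotone s) :
  let S := weighted_scalarization (positive_orthant R p) s in
  let alpha : R := s (\row_i (1 / s (delta_mx 0 i))) in
  [/\ ereal_inf [set ereal_sup [set max_ratio y ybar | y in level_set ybar s]
                | ybar in positive_orthant R p] = alpha%:E,
      forall (Q : minimization_problem R p) (I : instance R p), Q I ->
        forall P : set (feasible I),
          optimal_solution_set S P -> approximation_set alpha P &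
      forall eps : R, 0 < eps -> eps < 1 ->
        exists (Q : minimization_problem R p) (I : instance R p),
          Q I /\ ~ approximation_set (alpha * (1 - eps)) (@supported R p I S)].
Proof.
split.
- exact: (inf_sup_max_ratio s_norm s_mono (Ordinal p_gt0)).
- by move=> Q I _ P; exact: (optimal_approximation s_norm s_mono).
- move=> eps eps0 eps1.
  have [I notI] :=
    supported_not_approximation s_norm s_mono (Ordinal p_gt0) eps0 eps1.
  by exists [set: instance R p], I.
Qed.
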